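(* Let $\alpha,\beta>-1$ be real numbers and let $n\ge 0$ be an integer. For every integer $i$ with $0\le i\le n-2$, the dual Bernstein polynomials of degree $n$ satisfy the following identity of polynomials in $x$: $$u_0(i)D^n_i(x;\alpha,\beta)+u_1(i)D^n_{i+1}(x;\alpha,\beta)+u_2(i)D^n_{i+2}(x;\alpha,\beta)=0,$$ where $$u_0(i):=(x-1)(i+1)(n-i+\alpha)\,T^{(\alpha,\beta)}_{n,i+1}(x),$$ $$u_1(i):=x(n-i)(n-i+\alpha)\,T^{(\alpha,\beta)}_{n,i+1}(x)+(x-1)(i+2)(i+\beta+2)\,T^{(\alpha,\beta)}_{ni}(x),$$ $$u_2(i):=x(n-i-1)(i+\beta+2)\,T^{(\alpha,\beta)}_{ni}(x),$$ and $$T^{(\alpha,\beta)}_{ni}(x):=(n-i)(n+\alpha+1)\,x\,R^{(\alpha,\beta+1)}_n(x)+(i+1)(n+\beta+1)(1-x)\,R^{(\alpha+1,\beta)}_n(x),$$ with $R^{(a,b)}_n$ the shifted Jacobi polynomials.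
   Context: Pochhammer symbol: $(c)_0:=1$, $(c)_l:=c(c+1)\cdots(c+l-1)$ for $l\ge1$. Shifted Jacobi polynomials, for $a,b>-1$: $$R_n^{(a,b)}(x):=\frac{(a+1)_n}{n!}\sum_{k=0}^{n}\frac{(-n)_k(n+a+b+1)_k}{k!\,(a+1)_k}(1-x)^k.$$ Inner product: $\langle f,g\rangle_{\alpha,\beta}:=\int_0^1(1-x)^\alpha x^\beta f(x)g(x)\,dx$, with $\alpha,\beta>-1$. Bernstein basis polynomials: $B^n_i(x):=\binom{n}{i}x^i(1-x)^{n-i}$, $0\le i\le n$. Dual Bernstein polynomials of degree $n$: the unique polynomials $D^n_0(x;\alpha,\beta),\ldots,D^n_n(x;\alpha,\beta)$ of degree at most $n$ such that $\langle B^n_i,D^n_j(\cdot;\alpha,\beta)\rangle_{\alpha,\beta}=\delta_{ij}$ for $i,j=0,1,\ldots,n$. *)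

(* Defs.v *)
From mathcomp Require Import all_boot all_order all_algebra.
From mathcomp Require Import all_classical all_reals all_analysis.

Set Implicit Arguments.
Unset Strict Implicit.
Unset Printing Implicit Defensive.

Import Order.TTheory GRing.Theory Num.Theory.

Local Open Scope classical_set_scope.
Local Open Scope ring_scope.

Definition pochhammer (R : realType) (c : R) (l : nat) : R :=
  \prod_(0 <= k < l) (c + k%:R).

Definition shifted_jacobi (R : realType) (a b : R) (n : nat) : {poly R} :=
  (pochhammer (a + 1) n / n`!%:R) *:
  \sum_(0 <= k < n.+1)
    (pochhammer (- n%:R) k * pochhammer (n%:R + a + b + 1) k
     / (k`!%:R * pochhammer (a + 1) k)) *: (1 - 'X) ^+ k.

(* [powR 0 a] is 0 for every a != 0, also for a < 0; this convention only
   matters at the two endpoints, which are Lebesgue-negligible. *)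
Definition jacobi_inner (R : realType) (alpha beta : R) (f g : R -> R) : R :=
  Rintegral (@lebesgue_measure R) `[0, 1]
    (fun x => (1 - x) `^ alpha * x `^ beta * f x * g x).

Definition bernstein (R : realType) (n i : nat) : {poly R} :=
  'C(n, i)%:R *: ('X ^+ i * (1 - 'X) ^+ (n - i)).

(* Only D 0, ..., D n are constrained, and these are determined uniquely. *)
Definition is_dual_bernstein (R : realType) (alpha beta : R) (n : nat)
    (D : nat -> {poly R}) : Prop :=
  (forall j : nat, (j <= n)%N -> (size (D j) <= n.+1)%N) /\
  (forall i j : nat, (i <= n)%N -> (j <= n)%N ->
     jacobi_inner alpha beta (horner (bernstein R n i)) (horner (D j))
     = (i == j)%:R).

Section Coefficients.
Variables (R : realType) (alpha beta : R) (n : nat).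

Definition T_poly (i : nat) : {poly R} :=
  ((n%:R - i%:R) * (n%:R + alpha + 1)) *:
    ('X * shifted_jacobi alpha (beta + 1) n)
  + ((i%:R + 1) * (n%:R + beta + 1)) *:
    ((1 - 'X) * shifted_jacobi (alpha + 1) beta n).

Definition u0 (i : nat) : {poly R} :=
  ((i%:R + 1) * (n%:R - i%:R + alpha)) *: (('X - 1) * T_poly i.+1).

Definition u1 (i : nat) : {poly R} :=
  ((n%:R - i%:R) * (n%:R - i%:R + alpha)) *: ('X * T_poly i.+1)
  + ((i%:R + 2) * (i%:R + beta + 2)) *: (('X - 1) * T_poly i).

Definition u2 (i : nat) : {poly R} :=
  ((n%:R - i%:R - 1) * (i%:R + beta + 2)) *: ('X * T_poly i).

End Coefficients.

(* Main.v *)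
From HB Require Import structures.
Require Import Defs.
From mathcomp Require Import all_boot all_order all_algebra.
From mathcomp Require Import all_classical all_reals all_analysis.
From mathcomp Require Import measurable_realfun ring lra zify.
Set Implicit Arguments.
Unset Strict Implicit.
Unset Printing Implicit Defensive.

Import Order.TTheory GRing.Theory Num.Theory.
Import numFieldNormedType.Exports.
Local Open Scope classical_set_scope.
Local Open Scope ring_scope.

(** The recurrence mixes two instances of one closed formula.  Its terms group
    into [(n - i + alpha) T_(i+1) E_i + (i + beta + 2) T_i E_(i+1)], where
    [E_i = (i + 1) (x - 1) D_i + (n - i) x D_(i+1)], so everything follows from
    [E_i = c_i T_i] with constants such that
    [(i + beta + 2) c_(i+1) = - (n - i + alpha) c_i] (lemmas [dual_pairE] and
    [dual_pair_ratioS]).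

    Why [E_i] is a multiple of [T_i]: testing against Bernstein monomials of
    degree [n - 1], duality leaves two terms that cancel, so [E_i] is orthogonal
    to all polynomials of degree [< n].  The same holds for
    [x R_n^(alpha,beta+1)] and [(1 - x) R_n^(alpha+1,beta)], hence for their
    combination [T_i].  A polynomial of degree at most [n + 1] that is
    orthogonal to degree [< n] is determined by its values at 0 and 1
    ([orthogonal_endpoints_eq0]), so it is enough to compare these values.

    The endpoint values of the [D_j] come from duality too:
    [R_n^(alpha+1,beta)] is orthogonal to every multiple of [1 - x] of degree
    at most [n], so pairing it with [D_j] yields [D_j(1)] up to a factor
    independent of [j]; on the other hand the pairing is the [j]-th
    Bernstein coefficient of [R_n^(alpha+1,beta)].  These coefficients are
    explicit ([shifted_jacobiE]): the hypergeometric form and the Bernstein form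
    solve the same second-order equation, whose polynomial solutions are
    determined by their value at 0.  The point 0 is treated in the same way with
    [R_n^(alpha,beta+1)], and pairing the two Jacobi polynomials with each other
    relates the two unknown factors ([jacobi_endpoint_balance]).

    Besides linearity, all of this uses one property of the integral, the
    Pearson identity [jacobi_integral_pearson]: the integral over the unit interval of the
    derivative of [(1 - x)^(alpha+1) x^(beta+1) p] vanishes.  It is proved for
    the possibly unbounded weight by exhausting the open interval by segments;
    the rest is algebra about a linear functional on polynomials. *)

(** * The fundamental theorem of calculus on the open unit interval *)

(** The offset 3 makes every segment nondegenerate. *)
Definition inner_segment (R : realType) (k : nat) : set R :=
  `[k.+3%:R^-1, 1 - k.+3%:R^-1]%classic.

Arguments inner_segment : clear implicits.

Section InnerSegments.
Variable R : realType.
Local Notation mu := (@lebesgue_measure R).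
Local Notation I01 := (`]0%R, 1%R[%classic : set R).

Lemma inner_segment_bounds k :
  0 < k.+3%:R^-1 :> R /\ k.+3%:R^-1 < 1 - k.+3%:R^-1 :> R.
Proof.
split; first by rewrite invr_gt0 ltr0n.
have : k.+3%:R^-1 <= 3^-1 :> R by rewrite lef_pV2 ?posrE ?ltr0n// ler_nat.
by move: (k.+3%:R^-1) => e; lra.
Qed.

Lemma sub_inner_segment k : (inner_segment R k `<=` I01)%classic.
Proof.
have := inner_segment_bounds k.
rewrite /inner_segment; move: (k.+3%:R^-1) => e [? ?] x /=.
rewrite !in_itv/= => /andP[? ?]; apply/andP; lra.
Qed.

Lemma measurable_inner_segment k : measurable (inner_segment R k).
Proof. exact: measurable_itv. Qed.

Lemma inner_segment_cvg : k.+3%:R^-1 @[k --> \oo] --> (0 : R).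
Proof.
have := @cvg_harmonic R; rewrite -(cvg_shiftn 2).
by under eq_cvg do rewrite /harmonic/= addn2.
Qed.

Lemma near_inner_segment x : I01 x -> \forall k \near \oo, inner_segment R k x.
Proof.
rewrite /= in_itv/= => /andP[x0 x1].
have m0 : 0 < Num.min x (1 - x) by rewrite lt_min x0 subr_gt0.
have /cvgrPdist_lt/(_ _ m0) := inner_segment_cvg.
apply: filterS => k; rewrite sub0r normrN.
have := inner_segment_bounds k; rewrite /inner_segment.
move: (k.+3%:R^-1) => e [? ?]; rewrite gtr0_norm// lt_min => /andP[? ?].
rewrite /= in_itv/=; apply/andP; lra.
Qed.

Lemma nondecreasing_inner_segment : nondecreasing_seq (inner_segment R).
Proof.
move=> m k mk; apply/subsetPset => x; rewrite /inner_segment/= !in_itv/=.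
have h : k.+3%:R^-1 <= m.+3%:R^-1 :> R.
  by rewrite lef_pV2 ?posrE ?ltr0n// ler_nat.
move: (k.+3%:R^-1) (m.+3%:R^-1) h => e e' ? /andP[? ?]; apply/andP; lra.
Qed.

Lemma bigcup_inner_segment : (\bigcup_k inner_segment R k)%classic = I01.
Proof.
apply/seteqP; split=> [x [k _ /sub_inner_segment]//|x Ix].
have [k _ hk] := near_inner_segment Ix.
by exists k => //; apply: hk => /=.
Qed.

Variables F f : R -> R.
Hypothesis dF : forall x : R, 0 < x < 1 -> is_derive x 1 F (f x).
Hypothesis cf : {in `]0, 1[, continuous f}.

Lemma measurable_fun01 : measurable_fun I01 f.
Proof.
apply: open_continuous_measurable_fun; first exact: interval_open.
by move=> x; rewrite inE; exact: cf.
Qed.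

Lemma integral_inner_segment k :
  (\int[mu]_(x in inner_segment R k) (f x)%:E
   = (F (1 - k.+3%:R^-1) - F k.+3%:R^-1)%:E)%E.
Proof.
have [e0 e1] := inner_segment_bounds k.
have sub (x : R) : x \in `[k.+3%:R^-1, 1 - k.+3%:R^-1] -> 0 < x < 1.
  move: (k.+3%:R^-1) e0 e1 => e ? ?.
  rewrite in_itv/= => /andP[? ?]; apply/andP; lra.
have cF : {within inner_segment R k, continuous F}.
  by apply: derivable_within_continuous => x /sub /dF [].
rewrite /inner_segment (@continuous_FTC2 _ f F) //.
- apply: continuous_in_subspaceT => x; rewrite inE => /sub h.
  by apply: cf; rewrite in_itv.
- have [_ h1 h2] := (continuous_within_itvP _ e1).1 cF.
  by split => // x /subset_itv_oo_cc /sub /dF [].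
- by move=> x /subset_itv_oo_cc /sub /dF [_]; rewrite derive1E.
Qed.

Variables l0 l1 : R.
Hypothesis F0 : F x @[x --> 0^'+] --> l0.
Hypothesis F1 : F x @[x --> 1^'-] --> l1.

Lemma primitive_inner_segment_cvg :
  (F (1 - k.+3%:R^-1) - F k.+3%:R^-1) @[k --> \oo] --> l1 - l0.
Proof.
apply: cvgB.
  apply: (cvg_at_leftP _ _ _).1 F1 _ _; split=> [k|].
    by rewrite gtrBl; have [] := inner_segment_bounds k.
  rewrite -[X in _ --> X]subr0; apply: cvgB; first exact: cvg_cst.
  exact: inner_segment_cvg.
apply: (cvg_at_rightP _ _ _).1 F0 _ _; split=> [k|].
  by have [? ?] := inner_segment_bounds k.
exact: inner_segment_cvg.
Qed.

(** A nonnegative derivative of a function with finite one-sided limits at 0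
    and 1 is integrable even if it blows up there: the integrals over the inner
    segments are increments of the primitive, and monotone convergence
    applies. *)
Lemma integrable01_primitive :
  (forall x : R, 0 < x < 1 -> 0 <= f x) -> mu.-integrable I01 (EFin \o f).
Proof.
move=> f0; have mf := measurable_fun01.
apply/integrableP; split; first exact/measurable_EFinP.
rewrite (_ : (\int[mu]_(x in _) _)%E = (l1 - l0)%:E) ?ltry//.
transitivity (\int[mu]_(x in I01) (f x)%:E)%E.
  apply: eq_integral => x; rewrite inE/= in_itv/= => x01.
  by rewrite ger0_norm ?f0.
have lim : (\int[mu]_(x in inner_segment R k) (f x)%:E)%E @[k --> \oo]
    --> (l1 - l0)%:E.
  under eq_cvg do rewrite integral_inner_segment.
  by apply: cvg_EFin; [exact: nearW|exact: primitive_inner_segment_cvg].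
rewrite -bigcup_inner_segment; apply: cvg_unique lim => //.
apply: ge0_nondecreasing_set_cvg_integral.
- exact: nondecreasing_inner_segment.
- exact: measurable_inner_segment.
- move=> k; apply/measurable_EFinP; apply: measurable_funS mf => //.
  exact: sub_inner_segment.
- move=> k x /sub_inner_segment/=; rewrite in_itv/= => x01.
  by rewrite lee_fin f0.
Qed.

(** Dominated convergence along the inner segments, with the absolute value of
    the integrand itself as the dominating function. *)
Lemma integral01_primitive : mu.-integrable I01 (EFin \o f) ->
  \int[mu]_(x in `[0, 1]) f x = l1 - l0.
Proof.
move=> intf; have mf := measurable_fun01.
rewrite /Rintegral integral_itv_bndoo; last exact/measurable_EFinP.
rewrite (_ : (\int[mu]_(x in _) _)%E = (l1 - l0)%:E)//.
have [//||||||_ _ /= h] := @dominated_convergence _ _ R mu I01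
    _ (fun k => (EFin \o f) \_ (inner_segment R k))%E (EFin \o f)
    (fun x => `|(EFin \o f) x|)%E.
- move=> k; apply/measurable_restrict => //.
    exact: measurable_inner_segment.
  apply: (measurable_funS (E := I01)) => //.
  exact/measurable_EFinP.
- exact/measurable_EFinP.
- apply/aeW => x Ix; apply: cvg_near_cst.
  apply: filterS (near_inner_segment Ix) => k xk.
  by rewrite patchE mem_set.
- exact: integrable_abse.
- apply/aeW => x k Ix; rewrite patchE; case: ifP => // _.
  by rewrite abse0 abse_ge0.
apply: cvg_unique h _ => //.
have -> : (fun k => \int[mu]_(x in I01) ((EFin \o f) \_ (inner_segment R k)) x)%E
    = (fun k => (F (1 - k.+3%:R^-1) - F k.+3%:R^-1)%:E).
  apply/funext => k; rewrite -integral_inner_segment.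
  rewrite -integral_mkcondr; congr (integral _ _ _).
  by apply/setIidr; exact: sub_inner_segment.
by apply: cvg_EFin; [exact: nearW|exact: primitive_inner_segment_cvg].
Qed.

End InnerSegments.

(** * The Jacobi weight *)

(** The derivative of [(1 - x)^(a+1) x^(b+1) p] divided by the weight
    [(1 - x)^a x^b]. *)
Definition pearson (R : realType) (a b : R) (p : {poly R}) : {poly R} :=
  (b + 1) *: ((1 - 'X) * p) - (a + 1) *: ('X * p) + 'X * (1 - 'X) * p^`().

Definition jacobi_weight (R : realType) (a b x : R) : R :=
  (1 - x) `^ a * x `^ b.

Definition jacobi_integral (R : realType) (a b : R) (p : {poly R}) : R :=
  Rintegral (@lebesgue_measure R) `[0, 1]%classic
    (fun x => jacobi_weight a b x * p.[x]).

Section JacobiIntegral.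
Variable R : realType.
Local Notation mu := (@lebesgue_measure R).
Local Notation I01 := (`]0%R, 1%R[%classic : set R).

Lemma powR_onem_cvg0 (a : R) : 0 < a -> (1 - x) `^ a @[x --> 1^'-] --> (0 : R).
Proof.
move=> a0; apply/cvg_at_leftP => u [u1 cu].
apply: (cvg_at_rightP _ _ _).1 (powR_cvg0 a0) (fun n => 1 - u n) _.
split=> [n|]; first by rewrite subr_gt0.
by rewrite -[X in _ --> X](subrr 1); apply: cvgB => //; exact: cvg_cst.
Qed.

Lemma is_derive_powR_onem (a x : R) : x < 1 ->
  is_derive x 1 (fun y : R => (1 - y) `^ a) (- (a * (1 - x) `^ (a - 1))).
Proof.
move=> x1; have x1' : 0 < 1 - x by rewrite subr_gt0.
have h1 : is_derive x 1 (fun y : R => 1 - y) (-1).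
  have := is_deriveB (is_derive_cst (1 : R) x 1) (is_derive_id x 1).
  by rewrite sub0r.
have := @is_derive1_comp R (fun y => y `^ a) (fun y => 1 - y) x
  (a * (1 - x) `^ (a - 1)) (-1) (is_derive1_powR a x1') h1.
by rewrite mulrN1.
Qed.

Lemma is_derive_continuous (f : R -> R) (x d : R) :
  is_derive x 1 f d -> {for x, continuous f}.
Proof. by case=> df _; exact/differentiable_continuous/derivable1_diffP. Qed.

Lemma continuous_powR_onem (a x : R) : x < 1 ->
  {for x, continuous (fun y : R => (1 - y) `^ a)}.
Proof.
by move=> x1; exact: is_derive_continuous (is_derive_powR_onem a x1).
Qed.

Lemma continuous_powR (a x : R) : 0 < x ->
  {for x, continuous (fun y : R => y `^ a)}.
Proof. by move=> x0; exact: is_derive_continuous (is_derive1_powR a x0). Qed.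

Lemma integrable_powR01 (b : R) : -1 < b ->
  mu.-integrable I01 (fun x => (x `^ b)%:E).
Proof.
move=> b1; have b0 : 0 < b + 1 by lra.
apply: (@integrable01_primitive R (fun x => x `^ (b + 1) * (b + 1)^-1)
  (fun x => x `^ b) _ _ (0 * (b + 1)^-1) (1 `^ (b + 1) * (b + 1)^-1)).
- move=> x /andP[x0 _].
  have := is_derive1_powR (b + 1) x0; rewrite addrK => d.
  apply: is_derive_eq; rewrite scaler0 add0r /GRing.scale/=; field; lra.
- by move=> x; rewrite in_itv/= => /andP[x0 _]; exact: continuous_powR.
- by apply: cvgM; [exact: powR_cvg0|exact: cvg_cst].
- apply: cvg_at_left_filter; apply: cvgM; last exact: cvg_cst.
  exact: continuous_powR.
- by move=> x _; exact: powR_ge0.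
Qed.

Lemma integrable_powR_onem01 (a : R) : -1 < a ->
  mu.-integrable I01 (fun x => ((1 - x) `^ a)%:E).
Proof.
move=> a1; have a0 : 0 < a + 1 by lra.
apply: (@integrable01_primitive R (fun x => (1 - x) `^ (a + 1) * - (a + 1)^-1)
  (fun x => (1 - x) `^ a) _ _ ((1 - 0) `^ (a + 1) * - (a + 1)^-1)
  (0 * - (a + 1)^-1)).
- move=> x /andP[_ x1].
  have := is_derive_powR_onem (a + 1) x1; rewrite addrK => d.
  apply: is_derive_eq; rewrite scaler0 add0r /GRing.scale/=; field; lra.
- by move=> x; rewrite in_itv/= => /andP[_ x1]; exact: continuous_powR_onem.
- apply: cvg_at_right_filter; apply: cvgM; last exact: cvg_cst.
  exact: continuous_powR_onem.
- by apply: cvgM; [exact: powR_onem_cvg0|exact: cvg_cst].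
- by move=> x _; exact: powR_ge0.
Qed.

Lemma powR_succ (x a : R) : 0 < x -> x `^ (a + 1) = x `^ a * x.
Proof.
by move=> x0; rewrite powRD ?powRr1 ?ltW// (gt_eqF x0) implybT.
Qed.

Lemma powR_le1 (x a : R) : 0 < x <= 1 -> 0 <= a -> x `^ a <= 1.
Proof.
move=> /andP[x0 x1] a0; rewrite -(powRr0 x).
by rewrite ger_powR// x0.
Qed.

Variables a b : R.
Hypotheses (a1 : -1 < a) (b1 : -1 < b).

Lemma measurable_jacobi_weight (D : set R) :
  measurable_fun D (jacobi_weight a b).
Proof.
apply/measurable_funTS/measurable_funM; last exact: measurable_powR.
apply: (measurableT_comp (measurable_powR a)).
by apply: measurable_funB.
Qed.

(** Splitting [1 = (1 - x) + x] separates the two singularities: a positive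
    power of [1 - x] or of [x] is at most 1. *)
Lemma jacobi_weight_le (x : R) : 0 < x < 1 ->
  jacobi_weight a b x <= x `^ b + (1 - x) `^ a.
Proof.
move=> /andP[x0 x1]; have y0 : 0 < 1 - x by rewrite subr_gt0.
have -> : jacobi_weight a b x
    = (1 - x) `^ (a + 1) * x `^ b + (1 - x) `^ a * x `^ (b + 1).
  rewrite !powR_succ// /jacobi_weight; ring.
have [a0 b0] : 0 <= a + 1 /\ 0 <= b + 1 by move: a1 b1; lra.
apply: lerD.
  by rewrite ger_pMl ?powR_gt0//; apply: powR_le1 => //; apply/andP; lra.
by rewrite ger_pMr ?powR_gt0//; apply: powR_le1 => //; apply/andP; lra.
Qed.

Lemma integrable_jacobi_weight :
  mu.-integrable I01 (EFin \o jacobi_weight a b).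
Proof.
have gi : mu.-integrable I01
    ((fun x => (x `^ b)%:E) \+ (fun x => ((1 - x) `^ a)%:E))%E.
  by apply: integrableD => //;
    [exact: integrable_powR01|exact: integrable_powR_onem01].
apply: le_integrable gi => //.
  by apply/measurable_EFinP; exact: measurable_jacobi_weight.
move=> x /=; rewrite in_itv/= => x01.
rewrite lee_fin ger0_norm; last by rewrite mulr_ge0 ?powR_ge0.
by rewrite ger0_norm ?addr_ge0 ?powR_ge0 ?jacobi_weight_le.
Qed.

Lemma measurable_jacobi_integrand (D : set R) (p : {poly R}) :
  measurable_fun D (fun x => jacobi_weight a b x * p.[x]).
Proof.
apply: measurable_funM; first exact: measurable_jacobi_weight.
exact: measurable_poly.
Qed.

Lemma integrable_jacobi01 (p : {poly R}) :
  mu.-integrable I01 (fun x => (jacobi_weight a b x * p.[x])%:E).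
Proof.
have ch : {within `[0, 1], continuous (horner p)}.
  by apply: continuous_subspaceT; exact: continuous_horner.
have bp : [bounded p.[x] | x in I01].
  have /compact_bounded[M [_ mrt]] :=
    continuous_compact ch (@segment_compact R 0 1).
  exists M; split; rewrite ?num_real // => M' MM' x /= x01.
  by apply: (mrt _ MM'); exists x => //; exact: subset_itv_oo_cc x01.
rewrite (_ : (fun x => _)
    = ((EFin \o jacobi_weight a b) \* (EFin \o horner p))%E) //.
apply: integrableMl => //; first exact: integrable_jacobi_weight.
exact: measurable_poly.
Qed.

Lemma integrable_jacobi (p : {poly R}) :
  mu.-integrable `[0, 1]%classic (fun x => (jacobi_weight a b x * p.[x])%:E).
Proof.
apply/integrableP; split.
  by apply/measurable_EFinP; exact: measurable_jacobi_integrand.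
rewrite integral_itv_bndoo.
  by have /integrableP[] := integrable_jacobi01 p.
apply/measurableT_comp => //; apply/measurable_EFinP.
exact: measurable_jacobi_integrand.
Qed.

Lemma jacobi_integral_linear : linear_for *%R (@jacobi_integral R a b).
Proof.
move=> c p q; rewrite /jacobi_integral -RintegralZl//; last exact: integrable_jacobi.
rewrite -RintegralD//; last 2 first.
- have := integrable_jacobi (c *: p); apply: eq_integrable => // x _ /=.
  by rewrite hornerZ; congr EFin; ring.
- exact: integrable_jacobi.
apply: eq_Rintegral => x _; rewrite hornerD hornerZ; ring.
Qed.

(** The integrand is the derivative of [(1 - x)^(a+1) x^(b+1) p], which tends
    to 0 at both endpoints because [a + 1] and [b + 1] are positive. *)
Lemma jacobi_integral_pearson (p : {poly R}) :
  jacobi_integral a b (pearson a b p) = 0.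
Proof.
rewrite /jacobi_integral (@integral01_primitive R
  (fun x => (1 - x) `^ (a + 1) * x `^ (b + 1) * p.[x]) _ _ _
  ((1 - 0) `^ (a + 1) * 0 * p.[0]) (0 * 1 `^ (b + 1) * p.[1])).
- by rewrite mulr0 !mul0r subrr.
- move=> x /andP[x0 x1].
  have := is_derive_powR_onem (a + 1) x1; rewrite addrK => d1.
  have := is_derive1_powR (b + 1) x0; rewrite addrK => d2.
  apply: is_derive_eq; rewrite /GRing.scale/= /pearson /jacobi_weight.
  rewrite !(hornerD, hornerN, hornerM, hornerZ, hornerX, hornerC).
  rewrite !powR_succ ?subr_gt0//; ring.
- move=> x; rewrite in_itv/= => /andP[x0 x1].
  apply: cvgM; last exact: continuous_horner.
  by apply: cvgM; [exact: continuous_powR_onem|exact: continuous_powR].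
- apply: cvgM; last by apply: cvg_at_right_filter; exact: continuous_horner.
  apply: cvgM; last by apply: powR_cvg0; move: b1; lra.
  by apply: cvg_at_right_filter; exact: continuous_powR_onem.
- apply: cvgM; last by apply: cvg_at_left_filter; exact: continuous_horner.
  apply: cvgM; first by apply: powR_onem_cvg0; move: a1; lra.
  by apply: cvg_at_left_filter; exact: continuous_powR.
- exact: integrable_jacobi01.
Qed.

End JacobiIntegral.

(** * The Jacobi differential operator *)

(** The equation [jacobi_op n a b p = 0] is the hypergeometric equation
    [x (1 - x) p'' + ((b + 1) (1 - x) - (a + 1) x) p' + n (n + a + b + 1) p = 0]
    of the Jacobi polynomials. *)
Definition jacobi_op (R : realType) (n : nat) (a b : R) (p : {poly R}) :
    {poly R} :=
  pearson a b p^`() + (n%:R * (n%:R + a + b + 1)) *: p.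

Section JacobiOperator.
Variable R : realType.
Implicit Types (a b : R) (p q : {poly R}) (n k l : nat).

Lemma pearson_linear a b : linear (pearson a b).
Proof.
move=> c p q; rewrite /pearson derivD derivZ -!mul_polyC; ring.
Qed.

HB.instance Definition _ a b :=
  GRing.isLinear.Build R {poly R} {poly R} _ (pearson a b) (pearson_linear a b).

Lemma jacobi_op_linear n a b : linear (jacobi_op n a b).
Proof.
move=> c p q; rewrite /jacobi_op derivD derivZ linearP/= -!mul_polyC; ring.
Qed.

HB.instance Definition _ n a b :=
  GRing.isLinear.Build R {poly R} {poly R} _ (jacobi_op n a b)
    (jacobi_op_linear n a b).

Lemma deriv_bern_monomial k l :
  deriv ('X^k * (1 - 'X) ^+ l : {poly R})
  = k%:R *: ('X^(k.-1) * (1 - 'X) ^+ l) - l%:R *: ('X^k * (1 - 'X) ^+ l.-1).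
Proof.
rewrite derivM derivXn deriv_exp derivB derivX -[1]polyC1 derivC polyC1.
rewrite -(mulr_natl _ k) -(mulr_natl _ l) -!mul_polyC !polyC_natr; ring.
Qed.

Lemma pearson_bern_monomial a b k l :
  pearson a b ('X^k * (1 - 'X) ^+ l)
  = (b + 1 + k%:R) *: ('X^k * (1 - 'X) ^+ l.+1)
    - (a + 1 + l%:R) *: ('X^(k.+1) * (1 - 'X) ^+ l).
Proof.
rewrite /pearson deriv_bern_monomial -!mul_polyC !polyCD !polyC_natr.
move: (1 - 'X : {poly R}) => u; rewrite !exprS.
have hX : k%:R * ('X^(k.-1) * 'X) = k%:R * 'X^k :> {poly R}.
  by case: k => [|k]; rewrite ?mul0r//= -exprSr.
have hY : l%:R * (u ^+ l.-1 * u) = l%:R * u ^+ l :> {poly R}.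
  by case: l => [|l]; rewrite ?mul0r//= -exprSr.
ring: hX hY.
Qed.

(** When [n = k + l] the last term vanishes, so the operator maps a Bernstein
    monomial of degree [n] to two neighbouring ones of degree [n - 1]: solving
    the equation in the Bernstein basis is a two-term recursion.  For [k = 0] or
    [l = 0] the same formula covers the powers of [1 - x] and of [x]. *)
Lemma jacobi_op_bern_monomial n a b k l :
  jacobi_op n a b ('X^k * (1 - 'X) ^+ l)
  = (k%:R * (k%:R + b)) *: ('X^(k.-1) * (1 - 'X) ^+ l)
    + (l%:R * (l%:R + a)) *: ('X^k * (1 - 'X) ^+ l.-1)
    + ((n%:R - (k + l)%:R) * (n%:R + (k + l)%:R + a + b + 1))
      *: ('X^k * (1 - 'X) ^+ l).
Proof.
rewrite /jacobi_op deriv_bern_monomial linearB !linearZ/= !pearson_bern_monomial.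
case: k => [|k]; case: l => [|l];
  rewrite /= -!mul_polyC ?addn0 ?add0n ?addSn ?addnS ?exprS -?natr1 ?natrD; ring.
Qed.

(** Applied to a functional vanishing on the image of [pearson], this is the
    symmetry of the Jacobi operator. *)
Lemma jacobi_op_selfadjoint n a b p q :
  p * jacobi_op n a b q - jacobi_op n a b p * q
  = pearson a b (p * q^`() - p^`() * q).
Proof.
rewrite /jacobi_op /pearson derivB !derivM -!mul_polyC; ring.
Qed.

Lemma coef_jacobi_op n a b p k :
  (jacobi_op n a b p)`_k
  = k.+1%:R * (k.+1%:R + b) * p`_k.+1
    + (n%:R - k%:R) * (n%:R + k%:R + a + b + 1) * p`_k.
Proof.
have -> : jacobi_op n a b p = 'X * p^`()^`() - 'X * ('X * p^`()^`())
    + (b + 1) *: p^`() - (a + b + 2) *: ('X * p^`())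
    + (n%:R * (n%:R + a + b + 1)) *: p.
  by rewrite /jacobi_op /pearson -!mul_polyC; ring.
rewrite !(coefD, coefN, coefZ, coefXM, coef_deriv).
case: k => [|[|k]] /=; rewrite ?(coefXM, coef_deriv)/=; ring.
Qed.

(** The coefficient recursion never divides by zero since [k + 1 + b > 0], so
    [p.[0]] determines all the coefficients. *)
Lemma jacobi_op_eq0_horner0 n a b p : -1 < b ->
  jacobi_op n a b p = 0 -> p.[0] = 0 -> p = 0.
Proof.
move=> b1 hp p0; apply/polyP => k; rewrite coef0.
elim: k => [|k IH]; first by rewrite -horner_coef0.
have /eqP := coef_jacobi_op n a b p k.
rewrite hp coef0 IH mulr0 addr0 eq_sym !mulf_eq0 => /orP[/orP[]|/eqP//].
  by rewrite pnatr_eq0.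
have : 1 <= k.+1%:R :> R by rewrite ler1n.
by move=> h /eqP; lra.
Qed.

(** At order [k] the equation reads
    [(b + 1 + k) p_k = (a + b + 1 + k) p_(k-1)], with [b + 1 + k > 0]. *)
Lemma pearson_eq0 a b p : -1 < b -> pearson a b p = 0 -> p = 0.
Proof.
move=> b1 hp; apply/polyP => k; rewrite coef0.
have coefE j : (pearson a b p)`_j
    = (b + 1 + j%:R) * p`_j
      - (if j is j'.+1 then (a + b + 2 + j'%:R) * p`_j' else 0).
  have -> : pearson a b p = 'X * p^`() - 'X * ('X * p^`())
      + (b + 1) *: p - (a + b + 2) *: ('X * p).
    by rewrite /pearson -!mul_polyC; ring.
  rewrite !(coefD, coefN, coefZ, coefXM, coef_deriv).
  by case: j => [|[|j]] /=; rewrite ?(coefXM, coef_deriv)/=; ring.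
have bk j : b + 1 + j%:R != 0 by have := ler0n R j; lra.
elim: k => [|k IH].
  have /eqP := coefE 0; rewrite hp coef0 subr0 eq_sym mulf_eq0.
  by rewrite (negPf (bk 0)) => /eqP.
have /eqP := coefE k.+1; rewrite hp coef0 IH mulr0 subr0 eq_sym mulf_eq0.
by rewrite (negPf (bk _)) => /eqP.
Qed.

End JacobiOperator.

(** * Jacobi polynomials in the Bernstein basis *)

Definition bern_monomial (R : realType) (n k : nat) : {poly R} :=
  'X^k * (1 - 'X) ^+ (n - k).

Definition jacobi_bern_coef (R : realType) (a b : R) (n k : nat) : R :=
  (-1) ^+ k * pochhammer (b + k%:R + 1) (n - k)
  * pochhammer (a + (n - k)%:R + 1) k.

(** Up to a constant, this is the expansion that Leibniz' rule gives for
    Rodrigues' formula of the Jacobi polynomial. *)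
Definition jacobi_bern (R : realType) (a b : R) (n : nat) : {poly R} :=
  \sum_(0 <= k < n.+1)
    ('C(n, k)%:R * jacobi_bern_coef a b n k) *: bern_monomial R n k.

Section JacobiBernstein.
Variable R : realType.
Implicit Types (a b c : R) (p q : {poly R}) (n k l : nat).

Lemma pochhammer0 c : pochhammer c 0 = 1.
Proof. by rewrite /pochhammer big_geq. Qed.

Lemma pochhammerSr c n : pochhammer c n.+1 = pochhammer c n * (c + n%:R).
Proof. by rewrite /pochhammer big_nat_recr. Qed.

Lemma pochhammerSl c n : pochhammer c n.+1 = c * pochhammer (c + 1) n.
Proof.
rewrite /pochhammer big_nat_recl// addr0; congr (_ * _).
by apply: eq_bigr => k _; rewrite -addrA nat1r.
Qed.

Lemma pochhammer_gt0 c n : 0 < c -> 0 < pochhammer c n.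
Proof.
move=> c0; rewrite /pochhammer; apply: prodr_gt0 => k _.
by rewrite ltr_wpDr// ler0n.
Qed.

Lemma sum_shift_eq0 (V : zmodType) (F G : nat -> V) n :
  F 0 = 0 -> G n = 0 -> (forall k, (k < n)%N -> F k.+1 + G k = 0) ->
  \sum_(0 <= k < n.+1) (F k + G k) = 0.
Proof.
move=> F0 Gn FG; rewrite big_split/= big_nat_recl// F0 add0r.
rewrite [X in _ + X]big_nat_recr//= Gn addr0 -big_split/=.
by rewrite big_nat_cond big1// => k /andP[/andP[_ kn] _]; exact: FG.
Qed.

Lemma jacobi_op_shifted_jacobi n a b : -1 < a ->
  jacobi_op n a b (shifted_jacobi a b n) = 0.
Proof.
move=> a1; rewrite /shifted_jacobi linearZ/= linear_sum/=.
set c := fun k => pochhammer (- n%:R) k * pochhammer (n%:R + a + b + 1) k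
  / (k`!%:R * pochhammer (a + 1) k).
rewrite (_ : \sum_(0 <= k < n.+1) _ = 0) ?scaler0//.
transitivity (\sum_(0 <= k < n.+1)
  ((c k * (k%:R * (k%:R + a))) *: (1 - 'X : {poly R}) ^+ k.-1
   + (c k * ((n%:R - k%:R) * (n%:R + k%:R + a + b + 1)))
     *: (1 - 'X) ^+ k)).
  apply: eq_bigr => k _; rewrite linearZ/=.
  have -> : (1 - 'X) ^+ k = 'X^0 * (1 - 'X) ^+ k :> {poly R} by rewrite mul1r.
  rewrite jacobi_op_bern_monomial/= expr0 !mul1r mul0r scale0r add0r add0n.
  by rewrite scalerDr !scalerA.
apply: sum_shift_eq0; first by rewrite !(mul0r, mulr0) scale0r.
  by rewrite subrr !(mul0r, mulr0) scale0r.
move=> k kn /=; rewrite -scalerDl.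
suff -> : c k.+1 * (k.+1%:R * (k.+1%:R + a))
  + c k * ((n%:R - k%:R) * (n%:R + k%:R + a + b + 1)) = 0 by rewrite scale0r.
rewrite /c !pochhammerSr factS natrM.
have h1 : pochhammer (a + 1) k != 0 by rewrite gt_eqF// pochhammer_gt0//; lra.
have h2 : k`!%:R != 0 :> R by rewrite pnatr_eq0 -lt0n fact_gt0.
have h3 : k.+1%:R != 0 :> R by rewrite pnatr_eq0.
have h4 : a + 1 + k%:R != 0 by have := ler0n R k; lra.
by move: h1 h2 h3 h4; rewrite -!natr1 => *; field; do ?[apply/andP; split].
Qed.

Lemma jacobi_op_jacobi_bern n a b : jacobi_op n a b (jacobi_bern a b n) = 0.
Proof.
rewrite /jacobi_bern linear_sum/=.
set s := fun k => 'C(n, k)%:R * jacobi_bern_coef a b n k.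
transitivity (\sum_(0 <= k < n.+1)
  ((s k * (k%:R * (k%:R + b))) *: ('X^(k.-1) * (1 - 'X : {poly R}) ^+ (n - k))
   + (s k * ((n - k)%:R * ((n - k)%:R + a)))
     *: ('X^k * (1 - 'X) ^+ (n - k).-1))).
  rewrite !big_nat; apply: eq_bigr => k /andP[_ kn].
  rewrite linearZ/= jacobi_op_bern_monomial subnKC// subrr mul0r scale0r addr0.
  by rewrite scalerDr !scalerA.
apply: sum_shift_eq0; first by rewrite !(mul0r, mulr0) scale0r.
  by rewrite subnn !(mul0r, mulr0) scale0r.
move=> k kn /=; rewrite -subnS -scalerDl.
suff -> : s k.+1 * (k.+1%:R * (k.+1%:R + b))
  + s k * ((n - k)%:R * ((n - k)%:R + a)) = 0 by rewrite scale0r.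
rewrite /s /jacobi_bern_coef.
have hC : 'C(n, k.+1)%:R * k.+1%:R = 'C(n, k)%:R * (n - k)%:R :> R.
  by rewrite -!natrM mulnC mul_bin_left mulnC.
have -> : (n - k = (n - k.+1).+1)%N by rewrite subnSK.
move: hC; rewrite -(subnSK kn); move: (n - k.+1)%N => m.
rewrite exprS [pochhammer (b + k%:R + 1) _]pochhammerSl.
rewrite [pochhammer (a + m%:R + 1) _]pochhammerSl -!natr1.
rewrite -!(addrA b) -!(addrA a) => hC.
rewrite -!(addrA k%:R) -!(addrA m%:R) !(addrA k%:R 1) !(addrA m%:R 1).
move: (k%:R + 1) (m%:R + 1) hC => K M hC.
ring: hC.
Qed.

Lemma horner0_bern_monomial n k : (bern_monomial R n k).[0] = (k == 0)%:R.
Proof.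
rewrite !(hornerM, hornerXn, horner_exp, hornerD, hornerN, hornerX, hornerC).
by rewrite subr0 expr1n mulr1 expr0n.
Qed.

Lemma horner1_bern_monomial n k : (k <= n)%N ->
  (bern_monomial R n k).[1] = (k == n)%:R.
Proof.
move=> kn.
rewrite !(hornerM, hornerXn, horner_exp, hornerD, hornerN, hornerX, hornerC).
by rewrite subrr expr1n mul1r expr0n subn_eq0 eqn_leq kn.
Qed.

Lemma horner0_jacobi_bern n a b :
  (jacobi_bern a b n).[0] = pochhammer (b + 1) n.
Proof.
rewrite horner_sum big_nat_recl// big1 ?addr0; last first.
  by move=> k _; rewrite hornerZ horner0_bern_monomial mulr0.
rewrite hornerZ horner0_bern_monomial eqxx mulr1 bin0 mul1r.
by rewrite /jacobi_bern_coef expr0 mul1r pochhammer0 mulr1 addr0 subn0.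
Qed.

Lemma horner1_jacobi_bern n a b :
  (jacobi_bern a b n).[1] = (-1) ^+ n * pochhammer (a + 1) n.
Proof.
rewrite horner_sum big_nat_recr//= big_nat_cond big1 ?add0r; last first.
  move=> k /andP[/andP[_ kn] _].
  by rewrite hornerZ horner1_bern_monomial ?(ltnW kn)// ltn_eqF// mulr0.
rewrite hornerZ horner1_bern_monomial// eqxx mulr1 binn mul1r.
by rewrite /jacobi_bern_coef subnn pochhammer0 mulr1 addr0.
Qed.

Lemma horner1_shifted_jacobi n a b :
  (shifted_jacobi a b n).[1] = pochhammer (a + 1) n / n`!%:R.
Proof.
rewrite /shifted_jacobi hornerZ horner_sum big_nat_recl// big1 ?addr0.
  by rewrite hornerZ !pochhammer0 fact0 !mulr1 invr1 expr0 hornerC !mulr1.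
move=> k _; rewrite hornerZ horner_exp !(hornerD, hornerN, hornerX, hornerC).
by rewrite subrr exprS mul0r mulr0.
Qed.

(** Both sides solve the Jacobi equation, hence are proportional; the factor is
    found at [x = 1], where the hypergeometric sum has a single nonzero term. *)
Lemma shifted_jacobiE n a b : -1 < a -> -1 < b ->
  shifted_jacobi a b n = ((-1) ^+ n / n`!%:R) *: jacobi_bern a b n.
Proof.
move=> a1 b1; set r := shifted_jacobi a b n; set s := jacobi_bern a b n.
have opr : jacobi_op n a b r = 0 by exact: jacobi_op_shifted_jacobi.
have ops : jacobi_op n a b s = 0 by exact: jacobi_op_jacobi_bern.
have r1 : r.[1] = pochhammer (a + 1) n / n`!%:R by exact: horner1_shifted_jacobi.
have s0 : s.[0] = pochhammer (b + 1) n by exact: horner0_jacobi_bern.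
have s1 : s.[1] = (-1) ^+ n * pochhammer (a + 1) n.
  exact: horner1_jacobi_bern.
clearbody r s.
have pa : pochhammer (a + 1) n != 0 by rewrite gt_eqF// pochhammer_gt0//; lra.
have pb : pochhammer (b + 1) n != 0 by rewrite gt_eqF// pochhammer_gt0//; lra.
have fn : n`!%:R != 0 :> R by rewrite pnatr_eq0 -lt0n fact_gt0.
have /eqP : s.[0] *: r - r.[0] *: s = 0.
  apply: (@jacobi_op_eq0_horner0 R n a b) => //.
    by rewrite linearB !linearZ/= opr ops !(scaler0, oppr0, addr0).
  rewrite hornerD hornerN !hornerZ; ring.
rewrite subr_eq0 => /eqP h.
have := congr1 (horner^~ 1) h; rewrite !hornerZ r1 s1 s0 => e.
have sgn : (-1) ^+ n * (-1) ^+ n = 1 :> R by rewrite -expr2 sqrr_sign.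
have {}e : r.[0] = (-1) ^+ n / n`!%:R * pochhammer (b + 1) n.
  apply: (mulIf pa); rewrite -[LHS]mul1r -[X in X * _ = _]sgn.
  rewrite (_ : _ * _ = (-1) ^+ n * (r.[0] * ((-1) ^+ n * pochhammer (a + 1) n))).
    by rewrite -e; field.
  by ring.
by apply: (scalerI pb); rewrite -s0 h e s0 scalerA mulrC.
Qed.

End JacobiBernstein.

(** * Functionals that satisfy the Pearson identity *)

Section BernsteinSpan.
Variable R : realType.
Implicit Types (p q : {poly R}) (n k : nat).

Lemma size_onemX : size (1 - 'X : {poly R}) = 2.
Proof. by rewrite -opprB size_polyN size_XsubC. Qed.

Lemma size_bern_monomial n k : (k <= n)%N ->
  (size (bern_monomial R n k) <= n.+1)%N.
Proof.
move=> kn; apply: leq_trans (size_polyMleq _ _) _.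
have := size_poly_exp_leq (1 - 'X : {poly R}) (n - k).
rewrite size_onemX mul1n size_polyXn; move: (size _) => s; lia.
Qed.

Lemma horner_factor n p c : (size p <= n.+1)%N ->
  exists2 q : {poly R}, (size q <= n)%N & p = p.[c]%:P + q * ('X - c%:P).
Proof.
move=> sp; have : root (p - p.[c]%:P) c by rewrite /root !hornerE subrr.
case/factor_theorem => q hq; exists q; last by rewrite -hq addrC subrK.
have [->|q0] := eqVneq q 0; first by rewrite size_poly0.
have : (size (p - p.[c]%:P)%R <= n.+1)%N.
  apply: leq_trans (size_polyD _ _) _; rewrite geq_max sp size_polyN.
  by rewrite (leq_trans (size_polyC_leq1 _)).
by rewrite hq size_Mmonic ?monicXsubC// size_XsubC addn2.
Qed.

Lemma bern_monomialSS n k : bern_monomial R n.+1 k.+1 = 'X * bern_monomial R n k.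
Proof. by rewrite /bern_monomial subSS exprS mulrA. Qed.

Lemma bern_monomialS n k : (k <= n)%N ->
  bern_monomial R n.+1 k = (1 - 'X) * bern_monomial R n k.
Proof. by move=> kn; rewrite /bern_monomial subSn// exprS mulrCA. Qed.

(** Subtracting [p.[0] (1 - x)^(n+1)] leaves a multiple of [x], whose cofactor
    is expanded in degree [n]. *)
Lemma bern_span n p : (size p <= n.+1)%N ->
  exists c : nat -> R, p = \sum_(0 <= k < n.+1) c k *: bern_monomial R n k.
Proof.
elim: n p => [|n IH] p sp.
  exists (fun=> p`_0); rewrite big_nat1 /bern_monomial expr0 mul1r alg_polyC.
  exact: size1_polyC.
pose p' := p - p.[0] *: bern_monomial R n.+1 0.
have sp' : (size p' <= n.+2)%N.
  apply: leq_trans (size_polyD _ _) _; rewrite geq_max sp size_polyN.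
  exact: leq_trans (size_scale_leq _ _) (size_bern_monomial (leq0n _)).
have [q sq] := horner_factor 0 sp'.
rewrite hornerD hornerN hornerZ horner0_bern_monomial mulr1 subrr add0r subr0.
case: (IH q sq) => c -> e; exists (fun k => if k is k'.+1 then c k' else p.[0]).
rewrite big_nat_recl// -[LHS](subrK (p.[0] *: bern_monomial R n.+1 0)) addrC.
congr (_ + _); rewrite -/p' e big_distrl/=; apply: eq_bigr => k _.
by rewrite bern_monomialSS mulrC -scalerAr.
Qed.

Lemma size_jacobi_bern n a b : (size (jacobi_bern a b n : {poly R}) <= n.+1)%N.
Proof.
apply: leq_trans (size_sum _ _ _) _; rewrite big_nat_cond.
elim/big_ind: _ => // [x y|k /andP[/andP[_ kn] _]].
  by rewrite geq_max => ->.
by apply: leq_trans (size_scale_leq _ _) _; exact: size_bern_monomial.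
Qed.

End BernsteinSpan.

Section JacobiFunctional.
Variables (R : realType) (L : {scalar {poly R}}).
Implicit Types (a b : R) (p q g : {poly R}) (n : nat).

(** By symmetry of the operator, [p] is orthogonal to [jacobi_op n a b 'X^m].
    This is [(n - m) (n + m + a + b + 1)] times ['X^m] plus a multiple of
    ['X^(m-1)], and the factor is nonzero for [m < n]: induction on [m].  The
    polynomial [g] lets the functional for a shifted weight be written as
    [L (g * _)]. *)
Lemma jacobi_op_orthogonal a b n p q g : -1 < a -> -1 < b ->
  (forall r, L (g * pearson a b r) = 0) -> jacobi_op n a b p = 0 ->
  (size q <= n)%N -> L (g * (p * q)) = 0.
Proof.
move=> a1 b1 Lg op_p sq.
have mono m : (m < n)%N -> L (g * (p * 'X^m)) = 0.
  elim: m => [|m IH] mn.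
    have := Lg (p * deriv 'X^0 - deriv p * 'X^0).
    rewrite -(jacobi_op_selfadjoint n) op_p mul0r subr0.
    have := jacobi_op_bern_monomial n a b 0 0; rewrite !expr0 mulr1 => ->.
    rewrite !mul0r !scale0r !add0r subr0 -!scalerAr linearZ/= => /eqP.
    rewrite mulf_eq0 => /orP[|/eqP//]; have : 1 <= n%:R :> R by rewrite ler1n.
    by rewrite mulf_eq0 => ? /orP[]/eqP; lra.
  have := Lg (p * deriv 'X^(m.+1) - deriv p * 'X^(m.+1)).
  rewrite -(jacobi_op_selfadjoint n) op_p mul0r subr0.
  have := jacobi_op_bern_monomial n a b m.+1 0; rewrite !expr0 !mulr1/= => ->.
  rewrite addn0 mul0r scale0r addr0 (mulrDr p) (mulrDr g) -!scalerAr linearD !linearZ/=.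
  rewrite IH ?(ltnW mn)// mulr0 add0r => /eqP.
  have h1 : m.+1%:R + 1 <= n%:R :> R by rewrite natr1 ler_nat.
  have h2 : 1 <= m.+1%:R :> R by rewrite ler1n.
  rewrite mulf_eq0 => /orP[|/eqP//].
  by rewrite mulf_eq0 => /orP[]/eqP; lra.
rewrite -[q]coefK poly_def !mulr_sumr linear_sum/= big1// => m _.
by rewrite -!scalerAr linearZ/= mono ?mulr0// (leq_trans _ sq).
Qed.

Lemma bern_orthogonal n p q :
  (forall k, (k <= n)%N -> L (p * bern_monomial R n k) = 0) ->
  (size q <= n.+1)%N -> L (p * q) = 0.
Proof.
move=> Lp /bern_span[c ->]; rewrite mulr_sumr linear_sum/= big_nat_cond.
rewrite big1// => k /andP[/andP[_ kn] _].
by rewrite -scalerAr linearZ/= Lp ?mulr0.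
Qed.

Variables a b : R.
Hypothesis b1 : -1 < b.
Hypothesis Lpearson : forall p, L (pearson a b p) = 0.

(** Multiplying the weight by [1 - x] raises the first parameter by one. *)
Lemma pearson_onem p : L ((1 - 'X) * pearson (a + 1) b p) = 0.
Proof.
rewrite -(Lpearson ((1 - 'X) * p)); congr (L _).
rewrite /pearson derivM derivB derivX derivC -!mul_polyC.
ring.
Qed.

(** Multiplying the weight by [x] raises the second parameter by one. *)
Lemma pearson_X p : L ('X * pearson a (b + 1) p) = 0.
Proof.
rewrite -(Lpearson ('X * p)); congr (L _).
rewrite /pearson derivM derivX -!mul_polyC; ring.
Qed.

Variable n : nat.
Hypothesis nondegenerate : forall p, (size p <= n.+2)%N ->
  (forall q, (size q <= n.+2)%N -> L (p * q) = 0) -> p = 0.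

Lemma size_pearson p : (size p <= n.+1)%N -> (size (pearson a b p) <= n.+2)%N.
Proof.
move=> /bern_span[c ->]; rewrite linear_sum/=.
apply: leq_trans (size_sum _ _ _) _; rewrite big_nat_cond.
elim/big_ind: _ => // [x y|k /andP[/andP[_ kn] _]].
  by rewrite geq_max => ->.
rewrite linearZ/= pearson_bern_monomial.
apply: leq_trans (size_scale_leq _ _) _.
apply: leq_trans (size_polyD _ _) _; rewrite geq_max size_polyN.
apply/andP; split; apply: leq_trans (size_scale_leq _ _) _.
  by have := @size_bern_monomial R n.+1 k; rewrite /bern_monomial subSn//; apply; lia.
by have := @size_bern_monomial R n.+1 k.+1; rewrite /bern_monomial subSS; apply.
Qed.

(** Such a [p] is [- x (1 - x) r] with [r] of degree at most [n].  Integrating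
    [x (1 - x) r s'] by parts turns orthogonality to all derivatives [s'] into
    orthogonality of [pearson a b r] to all [s] of degree at most [n + 1].
    Nondegeneracy in this degree gives [pearson a b r = 0], hence [r = 0]. *)
Lemma orthogonal_endpoints_eq0 p : (size p <= n.+3)%N ->
  p.[0] = 0 -> p.[1] = 0 ->
  (forall q, (size q <= n.+1)%N -> L (p * q) = 0) -> p = 0.
Proof.
move=> sp p0 p1 Lp.
have [q sq eq] := horner_factor 0 sp; rewrite p0 add0r subr0 in eq.
have q1 : q.[1] = 0 by move: p1; rewrite eq hornerM hornerX mulr1.
have [r sr er] := horner_factor 1 sq; rewrite q1 add0r in er.
have ep : p = - ('X * (1 - 'X) * r) by rewrite eq er polyC1; ring.
suff r0 : r = 0 by rewrite ep r0 mulr0 oppr0.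
apply: (pearson_eq0 b1); apply: nondegenerate (size_pearson sr) _ => s ss.
have := Lpearson (r * s).
have -> : pearson a b (r * s) = pearson a b r * s - p * deriv s.
  by rewrite ep /pearson derivM -!mul_polyC; ring.
rewrite linearB/= Lp ?subr0//.
have [->|s0] := eqVneq s 0; first by rewrite linear0 size_poly0.
by rewrite -ltnS (leq_trans (lt_size_deriv s0)).
Qed.

End JacobiFunctional.

(** * Consecutive dual Bernstein polynomials *)

Section DualBernstein.
Variables (R : realType) (L : {scalar {poly R}}) (a b : R).
Hypotheses (a1 : -1 < a) (b1 : -1 < b).
Hypothesis Lpearson : forall p, L (pearson a b p) = 0.
Variables (m : nat) (D : nat -> {poly R}).
Let n := m.+1.
Implicit Types (p q : {poly R}) (i j k : nat).
Hypothesis size_D : forall j, (j <= n)%N -> (size (D j) <= n.+1)%N.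
Hypothesis dual_D : forall k j, (k <= n)%N -> (j <= n)%N ->
  'C(n, k)%:R * L (bern_monomial R n k * D j) = (k == j)%:R.

Lemma bin_neq0 k : (k <= n)%N -> 'C(n, k)%:R != 0 :> R.
Proof. by move=> kn; rewrite pnatr_eq0 -lt0n bin_gt0. Qed.

Lemma dual_bern_sum (c : nat -> R) j : (j <= n)%N ->
  L ((\sum_(0 <= k < n.+1) ('C(n, k)%:R * c k) *: bern_monomial R n k) * D j)
  = c j.
Proof.
move=> jn; rewrite big_distrl/= linear_sum/=.
transitivity (\sum_(0 <= k < n.+1) c k * (k == j)%:R).
  rewrite !big_nat; apply: eq_bigr => k /andP[_ kn].
  by rewrite -scalerAl linearZ/= -(dual_D kn jn); ring.
rewrite (bigD1_seq j) ?iota_uniq ?mem_index_iota//= eqxx mulr1.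
by rewrite big1 ?addr0// => k /negPf ->; rewrite mulr0.
Qed.

(** The existence of the dual family makes the pairing nondegenerate: pairing
    with [D_k] reads off the [k]-th Bernstein coefficient of [p]. *)
Lemma dual_nondegenerate p : (size p <= n.+1)%N ->
  (forall q, (size q <= n.+1)%N -> L (p * q) = 0) -> p = 0.
Proof.
move=> /bern_span[c ->] Lp; rewrite big_nat big1// => k /andP[_ kn].
have := @dual_bern_sum (fun k => c k / 'C(n, k)%:R) k kn.
have -> : \sum_(0 <= k < n.+1) ('C(n, k)%:R * (c k / 'C(n, k)%:R))
      *: bern_monomial R n k = \sum_(0 <= k < n.+1) c k *: bern_monomial R n k.
  rewrite !big_nat; apply: eq_bigr => l /andP[_ ln].
  by rewrite mulrC divfK ?bin_neq0.
rewrite Lp ?size_D// => /esym/eqP; rewrite mulf_eq0 invr_eq0.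
by rewrite (negPf (bin_neq0 kn)) orbF => /eqP ->; rewrite scale0r.
Qed.

Let A := jacobi_bern (a + 1) b n.
Let B := jacobi_bern a (b + 1) n.

(** [A] is orthogonal to [1 - x] times any polynomial of degree [< n], so
    pairing with it only sees the value at 1. *)
Lemma eval1_jacobi p : (size p <= n.+1)%N -> L (A * p) = p.[1] * L A.
Proof.
move=> sp; have [q sq ->] := horner_factor 1 sp.
rewrite hornerD hornerC hornerM !(hornerD, hornerN, hornerX, hornerC) subrr.
rewrite mulr0 addr0 mulrDr linearD/= mulrC mul_polyC linearZ/=.
rewrite [X in _ + X](_ : _ = 0) ?addr0//.
have -> : A * (q * ('X - 1%:P)) = - ((1 - 'X) * (A * q)) by rewrite polyC1; ring.
rewrite linearN/= (@jacobi_op_orthogonal R L (a + 1) b n) ?oppr0//.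
- by move: a1; lra.
- exact: pearson_onem.
- exact: jacobi_op_jacobi_bern.
Qed.

(** [B] is orthogonal to [x] times any polynomial of degree [< n], so pairing
    with it only sees the value at 0. *)
Lemma eval0_jacobi p : (size p <= n.+1)%N -> L (B * p) = p.[0] * L B.
Proof.
move=> sp; have [q sq ->] := horner_factor 0 sp.
rewrite hornerD hornerC hornerM !(hornerD, hornerN, hornerX, hornerC) subrr.
rewrite mulr0 addr0 mulrDr linearD/= mulrC mul_polyC linearZ/=.
rewrite [X in _ + X](_ : _ = 0) ?addr0//.
have -> : B * (q * ('X - 0%:P)) = 'X * (B * q) by rewrite polyC0; ring.
rewrite (@jacobi_op_orthogonal R L a (b + 1) n)//.
- by move: b1; lra.
- exact: pearson_X.
- exact: jacobi_op_jacobi_bern.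
Qed.

Lemma dual_horner1 j : (j <= n)%N ->
  (D j).[1] * L A = jacobi_bern_coef (a + 1) b n j.
Proof. by move=> jn; rewrite -eval1_jacobi ?size_D// dual_bern_sum. Qed.

Lemma dual_horner0 j : (j <= n)%N ->
  (D j).[0] * L B = jacobi_bern_coef a (b + 1) n j.
Proof. by move=> jn; rewrite -eval0_jacobi ?size_D// dual_bern_sum. Qed.

(** Both sides are the pairing of [A] with [B]. *)
Lemma jacobi_endpoint_balance : B.[1] * L A = A.[0] * L B.
Proof.
by rewrite -eval1_jacobi ?size_jacobi_bern// -eval0_jacobi ?size_jacobi_bern// mulrC.
Qed.

Let pa : pochhammer (a + 1) n != 0.
Proof. by rewrite gt_eqF// pochhammer_gt0//; move: a1; lra. Qed.

Let pb : pochhammer (b + 1) n != 0.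
Proof. by rewrite gt_eqF// pochhammer_gt0//; move: b1; lra. Qed.

Lemma dual_weight_neq0 : L B != 0.
Proof.
have := dual_horner0 (leq0n n).
rewrite /jacobi_bern_coef expr0 mul1r pochhammer0 mulr1 => h.
apply/negP => /eqP L0; move: h; rewrite L0 mulr0 => /esym/eqP.
by rewrite gt_eqF// pochhammer_gt0// addr0; move: b1; lra.
Qed.

(** The combination of [D_i] and [D_(i+1)] in which the duality relations
    cancel on polynomials of degree [< n]. *)
Definition dual_pair i : {poly R} :=
  (i%:R + 1) *: (('X - 1) * D i) + (n%:R - i%:R) *: ('X * D i.+1).

(** The polynomial [T_i] of the recurrence, up to the factor that relates
    the Jacobi polynomials to their Bernstein forms. *)
Definition dual_pair_shape i : {poly R} :=
  ((n%:R - i%:R) * (n%:R + a + 1)) *: ('X * B)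
  + ((i%:R + 1) * (n%:R + b + 1)) *: ((1 - 'X) * A).

(** The common part, up to sign, of the [i]-th Bernstein coefficient of [B] and
    the [i+1]-st one of [A], which are proportional to [D_i(0)] and
    [D_(i+1)(1)]. *)
Definition dual_pair_ratio i : R :=
  (-1) ^+ i * pochhammer (b + i%:R + 2) (n - i.+1)
  * pochhammer (a + (n - i)%:R + 1) i.

Lemma dual_pair_orthogonal i q : (i < n)%N -> (size q <= n)%N ->
  L (dual_pair i * q) = 0.
Proof.
move=> lin sq; apply: (@bern_orthogonal R L m) sq => k km.
(* Multiplying by x or 1 - x turns monomials of degree m into degree n. *)
have e1 : dual_pair i * bern_monomial R m k
    = (- (i%:R + 1)) *: (bern_monomial R n k * D i)
      + (n%:R - i%:R) *: (bern_monomial R n k.+1 * D i.+1).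
  by rewrite /dual_pair (bern_monomialS R km) bern_monomialSS -!mul_polyC; ring.
rewrite e1 linearD !linearZ/=.
have h1 := dual_D (leqW km) (ltnW lin); have h2 := dual_D (k := k.+1) km lin.
have {}h1 : L (bern_monomial R n k * D i) = (k == i)%:R / 'C(n, k)%:R.
  by rewrite -h1 (mulrC _ (L _)) mulfK// bin_neq0// leqW.
have {}h2 : L (bern_monomial R n k.+1 * D i.+1) = (k == i)%:R / 'C(n, k.+1)%:R.
  by rewrite -eqSS -h2 (mulrC _ (L _)) mulfK// bin_neq0.
rewrite h1 h2; have [->|_] := eqVneq k i; last first.
  by rewrite !(mulr0n, mul0r, mulr0, addr0).
have c1 := bin_neq0 (ltnW lin); have c2 := bin_neq0 lin.
have hC : (i%:R + 1) * 'C(n, i.+1)%:R = (n%:R - i%:R) * 'C(n, i)%:R :> R.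
  by rewrite natr1 -natrB ?(ltnW lin)// -!natrM mul_bin_left.
apply: (mulIf c1); apply: (mulIf c2); rewrite mul0r mul0r.
transitivity ((n%:R - i%:R) * 'C(n, i)%:R - (i%:R + 1) * 'C(n, i.+1)%:R : R).
  by rewrite /=; field; rewrite c1 c2.
by rewrite hC subrr.
Qed.

Lemma dual_pair_shape_orthogonal i q : (size q <= n)%N ->
  L (dual_pair_shape i * q) = 0.
Proof.
move=> sq; rewrite /dual_pair_shape mulrDl -!scalerAl linearD !linearZ/= -!mulrA.
rewrite (@jacobi_op_orthogonal R L a (b + 1) n)//; last 3 first.
- by move: b1; lra.
- exact: pearson_X.
- exact: jacobi_op_jacobi_bern.
rewrite (@jacobi_op_orthogonal R L (a + 1) b n)//; last 3 first.
- by move: a1; lra.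
- exact: pearson_onem.
- exact: jacobi_op_jacobi_bern.
by rewrite !mulr0 addr0.
Qed.

(** Both sides are orthogonal to degree [< n], so only the values at 0 and 1
    have to be compared: they involve [D_i(0)] and [D_(i+1)(1)] respectively,
    and [jacobi_endpoint_balance] makes the two factors agree. *)
Lemma dual_pairE i : (i < n)%N ->
  dual_pair i = (- dual_pair_ratio i / (pochhammer (b + 1) n * L B))
                *: dual_pair_shape i.
Proof.
move=> lin; have LB0 := dual_weight_neq0.
apply/eqP; rewrite -subr_eq0; apply/eqP.
have A0 : A.[0] = pochhammer (b + 1) n by exact: horner0_jacobi_bern.
have B1 : B.[1] = (-1) ^+ n * pochhammer (a + 1) n by exact: horner1_jacobi_bern.
have LA0 : L A != 0.
  apply/eqP => L0; have := jacobi_endpoint_balance; rewrite L0 mulr0 A0.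
  by move=> /esym/eqP; rewrite mulf_eq0 (negPf pb) (negPf LB0).
have B10 : B.[1] != 0 by rewrite B1 mulf_neq0// signr_eq0.
have size_lin (p q : {poly R}) c : (size p <= 2)%N -> (size q <= n.+1)%N ->
    (size (c *: (p * q)) <= n.+2)%N.
  move=> sp sq; apply: leq_trans (size_scale_leq _ _) _.
  apply: leq_trans (size_polyMleq _ _) _.
  by move: (size p) (size q) sp sq => s t; lia.
have sX : (size ('X : {poly R}) <= 2)%N by rewrite size_polyX.
have sX1 : (size ('X - 1 : {poly R})%R <= 2)%N by rewrite -polyC1 size_XsubC.
have s1X : (size (1 - 'X : {poly R})%R <= 2)%N by rewrite size_onemX.
have sD (p q : {poly R}) k : (size p <= k)%N -> (size q <= k)%N ->
    (size (p + q)%R <= k)%N.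
  by move=> sp sq; apply: leq_trans (size_polyD _ _) _; rewrite geq_max sp.
apply: (orthogonal_endpoints_eq0 b1 Lpearson (@dual_nondegenerate)).
- apply: (sD); rewrite ?size_polyN; last apply: leq_trans (size_scale_leq _ _) _.
    by apply: (sD); apply: size_lin => //; apply: size_D => //; exact: ltnW.
  by apply: (sD); apply: size_lin => //; exact: size_jacobi_bern.
- rewrite /dual_pair /dual_pair_shape.
  rewrite !(hornerD, hornerN, hornerZ, hornerM, hornerX, hornerC) A0.
  have := dual_horner0 (ltnW lin).
  have -> : jacobi_bern_coef a (b + 1) n i
      = dual_pair_ratio i * (n%:R + b + 1).
    rewrite /jacobi_bern_coef /dual_pair_ratio -(subnSK lin) pochhammerSr.
    rewrite -[in n%:R](subnKC lin) natrD -natr1.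
    rewrite (_ : b + 1 + i%:R + 1 = b + i%:R + 2); last by ring.
    ring.
  by move=> /(canRL (mulfK LB0)) ->; field; rewrite pb LB0.
- rewrite /dual_pair /dual_pair_shape.
  rewrite !(hornerD, hornerN, hornerZ, hornerM, hornerX, hornerC).
  rewrite -A0 -jacobi_endpoint_balance.
  have := dual_horner1 lin.
  have -> : jacobi_bern_coef (a + 1) b n i.+1
      = - (dual_pair_ratio i * (n%:R + a + 1)).
    rewrite /jacobi_bern_coef /dual_pair_ratio.
    rewrite (_ : a + 1 + (n - i.+1)%:R + 1 = a + (n - i)%:R + 1); last first.
      by rewrite -(subnSK lin) -natr1; ring.
    rewrite (_ : b + i.+1%:R + 1 = b + i%:R + 2); last by rewrite -natr1; ring.
    rewrite pochhammerSr exprS.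
    rewrite (_ : a + (n - i)%:R + 1 + i%:R = n%:R + a + 1); first by ring.
    by rewrite natrB ?(ltnW lin)//; ring.
  by move=> /(canRL (mulfK LA0)) ->; field; rewrite LA0 B10.
- move=> q sq; move: (- _ / _) => c.
  rewrite mulrBl -scalerAl linearB linearZ/= dual_pair_orthogonal//.
  by rewrite dual_pair_shape_orthogonal// mulr0 subr0.
Qed.

(** Passing from [i] to [i + 1] changes the sign, removes the factor [i + b + 2]
    from the first Pochhammer symbol and adds [n - i + a] to the second. *)
Lemma dual_pair_ratioS i : (i.+1 < n)%N ->
  dual_pair_ratio i.+1 * (i%:R + b + 2)
  = - (dual_pair_ratio i * (n%:R - i%:R + a)).
Proof.
move=> lin; rewrite /dual_pair_ratio -natrB; last by lia.
rewrite -(subnSK (ltnW lin)) -(subnSK lin); set k := (n - i.+2)%N.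
rewrite [pochhammer (b + i%:R + 2) _]pochhammerSl.
rewrite [pochhammer (a + k.+1%:R + 1) _]pochhammerSl exprS.
rewrite -[i.+1%:R]natr1 -[k.+2%:R]natr1 -[k.+1%:R]natr1.
rewrite (_ : b + (i%:R + 1) + 2 = b + i%:R + 2 + 1); last by ring.
rewrite (_ : a + (k%:R + 1) + 1 + 1 = a + (k%:R + 1 + 1) + 1); last by ring.
ring.
Qed.

Lemma dual_pair_recurrence i : (i.+1 < n)%N ->
  (n%:R - i%:R + a) *: (dual_pair_shape i.+1 * dual_pair i)
  + (i%:R + b + 2) *: (dual_pair_shape i * dual_pair i.+1) = 0.
Proof.
move=> lin; rewrite !dual_pairE ?(ltnW lin)// -!scalerAr !scalerA.
rewrite [dual_pair_shape i.+1 * _]mulrC -scalerDl.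
apply/eqP; rewrite scaler_eq0; apply/orP; left; apply/eqP.
have h := dual_pair_ratioS lin; have LB0 := dual_weight_neq0.
transitivity (- (dual_pair_ratio i.+1 * (i%:R + b + 2)
   + dual_pair_ratio i * (n%:R - i%:R + a)) / (pochhammer (b + 1) n * L B)).
  by field; rewrite LB0 pb.
by rewrite h addNr oppr0 mul0r.
Qed.

End DualBernstein.

(** * The three-term recurrence *)

Section Recurrence.
Variable R : realType.

Lemma jacobi_innerE (alpha beta : R) (p q : {poly R}) :
  jacobi_inner alpha beta (horner p) (horner q)
  = jacobi_integral alpha beta (p * q).
Proof.
by apply: eq_Rintegral => x _; rewrite hornerM mulrA.
Qed.

Lemma T_polyE (alpha beta : R) n i : -1 < alpha -> -1 < beta ->
  T_poly alpha beta n.+1 i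
  = ((-1) ^+ n.+1 / n.+1`!%:R) *: dual_pair_shape alpha beta n i.
Proof.
move=> ha hb.
have ha1 : -1 < alpha + 1 by lra.
have hb1 : -1 < beta + 1 by lra.
rewrite /T_poly /dual_pair_shape !shifted_jacobiE//.
rewrite -!mul_polyC; ring.
Qed.

End Recurrence.

Theorem corollary2p3 (R : realType) (alpha beta : R) (n : nat)
    (D : nat -> {poly R})
    (halpha : -1 < alpha) (hbeta : -1 < beta)
    (hD : is_dual_bernstein alpha beta n D)
    (i : nat) (hi : (i + 2 <= n)%N) :
  u0 alpha beta n i * D i + u1 alpha beta n i * D (i + 1)%N
    + u2 alpha beta n i * D (i + 2)%N = 0.
Proof.
case: n => [|m] in hD hi *; first by lia.
(* Linearity of the integral needs integrability of the weight, hence both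
   bounds on the exponents; the functional is packaged once they are known. *)
pose L : {scalar {poly R}} := HB.pack (jacobi_integral alpha beta)
  (GRing.isLinear.Build R {poly R} R *%R (jacobi_integral alpha beta)
    (jacobi_integral_linear halpha hbeta)).
have [size_D inner_D] := hD.
have dual_D k j : (k <= m.+1)%N -> (j <= m.+1)%N ->
    'C(m.+1, k)%:R * L (bern_monomial R m.+1 k * D j) = (k == j)%:R.
  move=> km jm; rewrite -(inner_D k j km jm) jacobi_innerE /bernstein.
  by rewrite -scalerAl -[jacobi_integral _ _ _]/(L _) linearZ.
have Lpearson p : L (pearson alpha beta p) = 0.
  exact: jacobi_integral_pearson.
have lim : (i.+1 < m.+1)%N by lia.
have := dual_pair_recurrence halpha hbeta Lpearson size_D dual_D lim.
rewrite /dual_pair addn1 addn2 /u0 /u1 /u2 !T_polyE// => rec.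
rewrite -[RHS](scaler0 _ ((-1) ^+ m.+1 / m.+1`!%:R)) -rec -[i.+1%:R]natr1.
rewrite -!mul_polyC; ring.
Qed.
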